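(* Let $n\ge 0$, let $R$ be an $n$-subperfect ring, and let $G$ be a finite group acting on $R$ (by ring automorphisms) such that the order of $G$ is a unit in $R$. Then the ring of invariants $R^G = \{r \in R : g(r)=r \text{ for all } g \in G\}$ is again an $n$-subperfect ring.
   Context: All rings are commutative with identity. A ring is perfect if every flat module over it is projective (equivalently, it satisfies the descending chain condition on principal ideals). $Q(A)$ denotes the total quotient ring of a ring $A$, and $A$ is subperfect if $Q(A)$ is perfect. A sequence $x_1,\ldots,x_i$ in $A$ is a regular sequence if $(x_1,\ldots,x_i)A\neq A$ and each $x_j$ is a non-zero-divisor on $A/(x_1,\ldots,x_{j-1})A$; the empty sequence is considered a regular sequence. A ring $A$ is regularly subperfect if for each regular sequence $x_1,\ldots,x_i$ in $A$ (including the empty one) the ring $A/(x_1,\ldots,x_i)A$ is subperfect. For an integer $n\ge 0$, $A$ is $n$-subperfect if $A$ is regularly subperfect and every maximal regular sequence in $A$ has length $n$. *)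

(* Defs.v *)
From HB Require Import structures.
From mathcomp Require Import all_boot fingroup action all_order all_algebra.
From mathcomp Require Import generic_quotient boolp.

Set Implicit Arguments.
Unset Strict Implicit.
Unset Printing Implicit Defensive.

Import GRing.Theory.
Local Open Scope ring_scope.
Local Open Scope quotient_scope.

(* A [comPzRingType] is any commutative ring with identity, possibly zero.    *)

Section SeqQuotient.
Variables (A : comPzRingType) (xs : seq A).

Definition seq_ideal : {pred A} :=
  fun a => `[< exists c : nat -> A, a = \sum_(i < size xs) c i * xs`_i >].

Lemma seq_idealP a :
  reflect (exists c : nat -> A, a = \sum_(i < size xs) c i * xs`_i)
          (a \in seq_ideal).
Proof. exact: asboolP. Qed.

Fact seq_ideal_zmod_closed : zmod_closed seq_ideal.
Proof.
split=> [|x y /seq_idealP[c ->] /seq_idealP[d ->]]; apply/seq_idealP.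
  by exists (fun=> 0); rewrite big1 // => i _; rewrite mul0r.
exists (fun i => c i - d i); rewrite -sumrB.
by apply: eq_bigr => i _; rewrite mulrBl.
Qed.

HB.instance Definition _ :=
  GRing.isZmodClosed.Build A seq_ideal seq_ideal_zmod_closed.

Lemma seq_idealMl a x : x \in seq_ideal -> a * x \in seq_ideal.
Proof.
move=> /seq_idealP[c ->]; apply/seq_idealP; exists (fun i => a * c i).
by rewrite mulr_sumr; apply: eq_bigr => i _; rewrite mulrA.
Qed.

(* The library's quotient rings are restricted to proper ideals; only the     *)
(* quotient of the additive group is reused here.                             *)
Definition seq_quot : Type := Quotient.quot seq_ideal.

HB.instance Definition _ := GRing.Zmodule.on seq_quot.
HB.instance Definition _ := EqQuotient.on seq_quot.

Definition seq_pi (a : A) : seq_quot := \pi_(Quotient.quot seq_ideal) a.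

Lemma seq_piP a b : seq_pi a = seq_pi b <-> a - b \in seq_ideal.
Proof.
by rewrite Quotient.idealrBE; split=> [h|/eqP h]; [apply/eqP|]; exact: h.
Qed.

Definition seq_quot_one : seq_quot := seq_pi 1.
Definition seq_quot_mul (x y : seq_quot) : seq_quot :=
  seq_pi (repr x * repr y).

Lemma seq_pi_repr x : seq_pi (repr x) = x. Proof. exact: reprK. Qed.

Lemma seq_piB : zmod_morphism seq_pi.
Proof. by move=> x y; rewrite /seq_pi raddfB. Qed.

HB.instance Definition _ := GRing.isZmodMorphism.Build A seq_quot seq_pi seq_piB.

Lemma seq_piM a b : seq_pi (a * b) = seq_quot_mul (seq_pi a) (seq_pi b).
Proof.
apply/seq_piP; set a' := repr _; set b' := repr _.
have ha : a - a' \in seq_ideal by apply/seq_piP; rewrite seq_pi_repr.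
have hb : b - b' \in seq_ideal by apply/seq_piP; rewrite seq_pi_repr.
have -> : a * b - a' * b' = b * (a - a') + a' * (b - b').
  by rewrite !mulrBr (mulrC b a) (mulrC b a') addrA subrK.
by rewrite rpredD ?seq_idealMl.
Qed.

Fact seq_quot_mulA : associative seq_quot_mul.
Proof.
move=> x y z; rewrite -[x]seq_pi_repr -[y]seq_pi_repr -[z]seq_pi_repr.
by rewrite -!seq_piM mulrA.
Qed.

Fact seq_quot_mulC : commutative seq_quot_mul.
Proof. by move=> x y; rewrite /seq_quot_mul mulrC. Qed.

Fact seq_quot_mul1 : left_id seq_quot_one seq_quot_mul.
Proof. by move=> x; rewrite -[x]seq_pi_repr -seq_piM mul1r. Qed.

Fact seq_quot_mulDl : left_distributive seq_quot_mul +%R.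
Proof.
move=> x y z; rewrite -[x]seq_pi_repr -[y]seq_pi_repr -[z]seq_pi_repr.
by rewrite -raddfD -!seq_piM mulrDl raddfD.
Qed.

HB.instance Definition _ := GRing.Zmodule_isComPzRing.Build seq_quot
  seq_quot_mulA seq_quot_mulC seq_quot_mul1 seq_quot_mulDl.

Fact seq_pi_monoid_morphism : monoid_morphism seq_pi.
Proof. by split=> // a b; exact: seq_piM. Qed.

HB.instance Definition _ :=
  GRing.isMonoidMorphism.Build A seq_quot seq_pi seq_pi_monoid_morphism.

End SeqQuotient.

Section TotalQuotient.
Variable A : comPzRingType.

Definition nonzerodivisor (s : A) : Prop := forall a : A, s * a = 0 -> a = 0.

Definition nzd : {pred A} := fun s => `[< nonzerodivisor s >].

Lemma nzdI (s a b : A) : s \in nzd -> s * a = s * b -> a = b.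
Proof.
by move=> /asboolP sP /eqP; rewrite -subr_eq0 -mulrBr => /eqP/sP/eqP;
  rewrite subr_eq0 => /eqP.
Qed.

Lemma nzd1 : 1 \in nzd. Proof. by apply/asboolP => a; rewrite mul1r. Qed.

Lemma nzdM (s t : A) : s \in nzd -> t \in nzd -> s * t \in nzd.
Proof.
by move=> /asboolP sP /asboolP tP; apply/asboolP => a;
  rewrite -mulrA => /sP/tP.
Qed.

Definition frac_pair : Type := (A * {s : A | s \in nzd})%type.
HB.instance Definition _ := Choice.on frac_pair.

Definition mk_frac a s (sP : s \in nzd) : frac_pair := (a, exist _ s sP).
Definition num (x : frac_pair) : A := x.1.
Definition den (x : frac_pair) : A := val x.2.

Lemma den_nzd x : den x \in nzd. Proof. exact: (valP x.2). Qed.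

Definition frac_equiv (x y : frac_pair) : bool :=
  num x * den y == num y * den x.

Fact frac_equiv_class : equiv_class_of frac_equiv.
Proof.
split=> [x|x y|y x z]; rewrite /frac_equiv; [exact: eqxx | exact: eq_sym |].
move=> /eqP xy /eqP yz; apply/eqP/(nzdI (den_nzd y)).
by rewrite mulrA (mulrC (den y)) xy mulrAC yz -mulrA mulrCA.
Qed.

Canonical frac_equiv_rel := EquivRelPack frac_equiv_class.
Canonical frac_enc_rel := defaultEncModRel frac_equiv.

Definition total_quot : Type := {eq_quot frac_equiv}.
HB.instance Definition _ : EqQuotient frac_pair frac_equiv total_quot :=
  EqQuotient.on total_quot.
HB.instance Definition _ := Choice.on total_quot.

Definition frac a s (sP : s \in nzd) : total_quot :=
  \pi_total_quot (mk_frac a sP).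

Lemma fracP a s (sP : s \in nzd) b t (tP : t \in nzd) :
  frac a sP = frac b tP <-> a * t = b * s.
Proof.
split=> [/eqmodP/eqP //|h].
by apply/eqmodP; rewrite /= /frac_equiv /num /den /= h.
Qed.

Lemma frac_repr x : frac (num (repr x)) (den_nzd (repr x)) = x.
Proof.
by rewrite -[RHS]reprK /frac; congr \pi; case: (repr x) => a [s sP];
  rewrite /mk_frac; congr (_, exist _ _ _); exact: bool_irrelevance.
Qed.

Lemma fracE x : exists a s (sP : s \in nzd), x = frac a sP.
Proof. by do 3!eexists; rewrite -[LHS]frac_repr. Qed.

Definition tq_zero : total_quot := frac 0 nzd1.
Definition tq_one : total_quot := frac 1 nzd1.
Definition tq_opp (x : total_quot) : total_quot :=
  frac (- num (repr x)) (den_nzd (repr x)).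
Definition tq_add (x y : total_quot) : total_quot :=
  frac (num (repr x) * den (repr y) + num (repr y) * den (repr x))
       (nzdM (den_nzd (repr x)) (den_nzd (repr y))).
Definition tq_mul (x y : total_quot) : total_quot :=
  frac (num (repr x) * num (repr y))
       (nzdM (den_nzd (repr x)) (den_nzd (repr y))).

Lemma repr_frac a s (sP : s \in nzd) :
  num (repr (frac a sP)) * s = a * den (repr (frac a sP)).
Proof. by apply/(fracP _ (den_nzd (repr (frac a sP))) _ sP)/frac_repr. Qed.

Lemma frac_opp a s (sP : s \in nzd) : tq_opp (frac a sP) = frac (- a) sP.
Proof. by apply/fracP; rewrite !mulNr repr_frac. Qed.

Lemma frac_add a s (sP : s \in nzd) b t (tP : t \in nzd) :
  tq_add (frac a sP) (frac b tP) = frac (a * t + b * s) (nzdM sP tP).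
Proof.
apply/fracP; have := repr_frac a sP; have := repr_frac b tP.
set y := repr (frac b tP); set x := repr (frac a sP) => hy hx.
rewrite !mulrDl; congr (_ + _).
  by rewrite mulrACA hx [RHS]mulrACA (mulrC t).
by rewrite (mulrC s t) mulrACA hy (mulrC (den x) (den y)) [RHS]mulrACA (mulrC s).
Qed.

Lemma frac_mul a s (sP : s \in nzd) b t (tP : t \in nzd) :
  tq_mul (frac a sP) (frac b tP) = frac (a * b) (nzdM sP tP).
Proof. by apply/fracP; rewrite mulrACA !repr_frac mulrACA. Qed.

Fact tq_addA : associative tq_add.
Proof.
move=> x y z; case: (fracE x) (fracE y) (fracE z).
move=> a [s [sP ->]] [b [t [tP ->]]] [c [u [uP ->]]].
rewrite !frac_add; apply/fracP; rewrite (mulrA s t u); congr (_ * _).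
by rewrite !mulrDl !mulrA -!addrA; congr (_ + (_ + _)); rewrite // mulrAC.
Qed.

Fact tq_addC : commutative tq_add.
Proof.
move=> x y; case: (fracE x) (fracE y) => a [s [sP ->]] [b [t [tP ->]]].
by rewrite !frac_add; apply/fracP; rewrite addrC (mulrC s).
Qed.

Fact tq_add0 : left_id tq_zero tq_add.
Proof.
move=> x; case: (fracE x) => a [s [sP ->]].
by rewrite frac_add; apply/fracP; rewrite mul0r add0r mulr1 mul1r.
Qed.

Fact tq_addN : left_inverse tq_zero tq_opp tq_add.
Proof.
move=> x; case: (fracE x) => a [s [sP ->]].
by rewrite frac_opp frac_add; apply/fracP; rewrite mulNr addNr !mul0r.
Qed.

HB.instance Definition _ :=
  GRing.isZmodule.Build total_quot tq_addA tq_addC tq_add0 tq_addN.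

Fact tq_mulA : associative tq_mul.
Proof.
move=> x y z; case: (fracE x) (fracE y) (fracE z).
move=> a [s [sP ->]] [b [t [tP ->]]] [c [u [uP ->]]].
by rewrite !frac_mul; apply/fracP; rewrite !mulrA.
Qed.

Fact tq_mulC : commutative tq_mul.
Proof.
move=> x y; case: (fracE x) (fracE y) => a [s [sP ->]] [b [t [tP ->]]].
by rewrite !frac_mul; apply/fracP; rewrite (mulrC a) (mulrC s).
Qed.

Fact tq_mul1 : left_id tq_one tq_mul.
Proof.
move=> x; case: (fracE x) => a [s [sP ->]].
by rewrite frac_mul; apply/fracP; rewrite !mul1r.
Qed.

Fact tq_mulDl : left_distributive tq_mul tq_add.
Proof.
move=> x y z; case: (fracE x) (fracE y) (fracE z).
move=> a [s [sP ->]] [b [t [tP ->]]] [c [u [uP ->]]].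
rewrite !(frac_add, frac_mul); apply/fracP.
have -> : a * c * (t * u) + b * c * (s * u) = (a * t + b * s) * c * u.
  by rewrite !mulrDl; congr (_ + _); rewrite mulrACA !mulrA.
by rewrite -[RHS]mulrA; congr (_ * _); rewrite mulrACA [RHS]mulrC mulrA.
Qed.

HB.instance Definition _ := GRing.Zmodule_isComPzRing.Build total_quot
  tq_mulA tq_mulC tq_mul1 tq_mulDl.

End TotalQuotient.

(* The tensor product M (x)_A N: formal sums of pairs (m, n), represented by  *)
(* finite sequences, modulo the congruence generated by bilinearity.          *)

Section Tensor.
Variables (A : comPzRingType) (M N : lmodType A).

Inductive tensor_rel : seq (M * N) -> seq (M * N) -> Prop :=
| tensor_refl s : tensor_rel s s
| tensor_sym s t : tensor_rel s t -> tensor_rel t s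
| tensor_trans s t u : tensor_rel s t -> tensor_rel t u -> tensor_rel s u
| tensor_cat s s' t t' :
    tensor_rel s s' -> tensor_rel t t' -> tensor_rel (s ++ t) (s' ++ t')
| tensor_catC s t : tensor_rel (s ++ t) (t ++ s)
| tensor_zero n : tensor_rel [:: (0, n)] [::]
| tensor_addl m m' n : tensor_rel [:: (m + m', n)] [:: (m, n); (m', n)]
| tensor_addr m n n' : tensor_rel [:: (m, n + n')] [:: (m, n); (m, n')]
| tensor_scale a m n : tensor_rel [:: (a *: m, n)] [:: (m, a *: n)].

Definition tensor_equiv (s t : seq (M * N)) : bool := `[< tensor_rel s t >].

Fact tensor_equiv_class : equiv_class_of tensor_equiv.
Proof.
split=> [s|s t|t s u]; first exact/asboolP/tensor_refl.
  by apply/asboolP/asboolP; exact: tensor_sym.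
by move=> /asboolP st /asboolP tu; apply/asboolP; exact: tensor_trans tu.
Qed.

Canonical tensor_equiv_rel := EquivRelPack tensor_equiv_class.
Canonical tensor_enc_rel := defaultEncModRel tensor_equiv.

Definition tensor : Type := {eq_quot tensor_equiv}.
HB.instance Definition _ : EqQuotient (seq (M * N)) tensor_equiv tensor :=
  EqQuotient.on tensor.
HB.instance Definition _ := Choice.on tensor.

Definition tensor_pi (s : seq (M * N)) : tensor := \pi_tensor s.

Lemma tensor_piP s t : tensor_pi s = tensor_pi t <-> tensor_rel s t.
Proof. by split=> [/eqmodP/asboolP //|h]; apply/eqmodP/asboolP. Qed.

Lemma tensor_pi_repr x : tensor_pi (repr x) = x. Proof. exact: reprK. Qed.

End Tensor.

Section TensorMap.
Variables (A : comPzRingType) (M N N' : lmodType A) (f : {linear N -> N'}).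

Definition tensor_map_seq (s : seq (M * N)) : seq (M * N') :=
  [seq (p.1, f p.2) | p <- s].

Definition tensor_map (x : tensor M N) : tensor M N' :=
  tensor_pi (tensor_map_seq (repr x)).

Lemma tensor_map_rel s t :
  tensor_rel s t -> tensor_rel (tensor_map_seq s) (tensor_map_seq t).
Proof.
elim=> {s t} /=.
- by move=> s; exact: tensor_refl.
- by move=> s t _ /tensor_sym.
- by move=> s t u _ st _; exact: tensor_trans.
- by move=> s s' t t' _ hs _ ht; rewrite /tensor_map_seq !map_cat;
    exact: tensor_cat.
- by move=> s t; rewrite /tensor_map_seq !map_cat; exact: tensor_catC.
- by move=> n; exact: tensor_zero.
- by move=> m m' n; exact: tensor_addl.
- by move=> m n n'; rewrite raddfD; exact: tensor_addr.
- by move=> a m n; rewrite linearZ; exact: tensor_scale.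
Qed.

Lemma tensor_mapE s : tensor_map (tensor_pi s) = tensor_pi (tensor_map_seq s).
Proof.
by apply/tensor_piP/tensor_map_rel/tensor_piP; exact: tensor_pi_repr.
Qed.

End TensorMap.

Section Perfect.
Variable A : comPzRingType.

Definition flat (M : lmodType A) : Prop :=
  forall (N N' : lmodType A) (f : {linear N -> N'}),
    injective f -> injective (@tensor_map A M N N' f).

Definition projective (M : lmodType A) : Prop :=
  forall (N P : lmodType A) (g : {linear N -> P}) (f : {linear M -> P}),
    (forall y, exists x, g x = y) ->
    exists h : {linear M -> N}, forall x, g (h x) = f x.

Definition perfect : Prop := forall M : lmodType A, flat M -> projective M.

End Perfect.

Section Subperfect.
Variable A : comPzRingType.

Definition subperfect (B : comPzRingType) : Prop := perfect (total_quot B).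

(* The j-th condition is that x_j is a non-zero-divisor on                    *)
(* A/(x_1, ..., x_{j-1})A; indices are shifted since sequences start at 0.    *)
(* The case [xs = [::]] matters only for the zero ring.                       *)
Definition regular_sequence (xs : seq A) : Prop :=
  xs = [::] \/
  ((exists a : A, a \notin seq_ideal xs) /\
   forall j, (j < size xs)%N -> nonzerodivisor (seq_pi (take j xs) xs`_j)).

Definition maximal_regular_sequence (xs : seq A) : Prop :=
  regular_sequence xs /\ forall y : A, ~ regular_sequence (rcons xs y).

Definition regularly_subperfect : Prop :=
  forall xs : seq A, regular_sequence xs -> subperfect (seq_quot xs).

Definition n_subperfect (n : nat) : Prop :=
  regularly_subperfect /\
  forall xs : seq A, maximal_regular_sequence xs -> size xs = n.

End Subperfect.

(* MathComp actions are right actions, to x (g * h) = to (to x g) h; passing  *)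
(* from a left action to x |-> to x g^-1 changes neither the group of         *)
(* automorphisms nor the invariants.                                          *)

Record ring_action (G : finGroupType) (R : comPzRingType) := RingAction {
  ring_act :> {action G &-> R};
  ring_act_zmod : forall g : G, zmod_morphism (ring_act^~ g);
  ring_act_monoid : forall g : G, monoid_morphism (ring_act^~ g)
}.

Section Invariants.
Variables (G : finGroupType) (R : comPzRingType) (to : ring_action G R).

Definition invariant : {pred R} := fun r => `[< forall g : G, to r g = r >].

Lemma invariantP r : reflect (forall g : G, to r g = r) (r \in invariant).
Proof. exact: asboolP. Qed.

Fact invariant_subring_closed : subring_closed invariant.
Proof.
split=> [|x y /invariantP xP /invariantP yP|x y /invariantP xP /invariantP yP];
  apply/invariantP => g.
- by case: (ring_act_monoid to g).
- by rewrite (ring_act_zmod to g) xP yP.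
- by rewrite (ring_act_monoid to g).2 xP yP.
Qed.

HB.instance Definition _ :=
  GRing.isSubringClosed.Build R invariant invariant_subring_closed.

Record invariants := Invariants { inv_val : R; _ : inv_val \in invariant }.

HB.instance Definition _ := [isSub for inv_val].
HB.instance Definition _ := [Choice of invariants by <:].
HB.instance Definition _ :=
  GRing.SubChoice_isSubComPzRing.Build R invariant invariants
    invariant_subring_closed.

End Invariants.

(* Main.v *)
Require Import Defs.
From HB Require Import structures.
From mathcomp Require Import all_boot fingroup action all_order all_algebra.
From mathcomp Require Import generic_quotient boolp functions.
Import GRing.Theory.
Set Implicit Arguments.
Unset Strict Implicit.
Unset Printing Implicit Defensive.
Local Open Scope ring_scope.

(** Write [S] for the ring of invariants of [R]. Two facts about the inclusion
    of [S] in [R] carry the proof: averaging over the group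
    is an [S]-linear retraction of [R] onto [S], and every [s] in [R] divides
    an invariant, its norm, which is a non-zero-divisor modulo an ideal
    generated by invariants as soon as [s] is. The theorem is proved for every
    ring morphism [i : S -> R] with these two properties
    ([n_subperfect_descent]).

    Perfectness descends along a ring morphism [i : B -> A] with a [B]-linear
    retraction [r] ([perfect_descent]). If [M] is flat over [B], then
    [M (x) A] is flat over [A], hence projective. To lift [f : M -> P] along a
    surjection [g : N -> P], lift [f (x) A] along [g (x) A] to an [A]-linear
    [h], and take [m |-> (N (x) r) (h (m (x) 1))]; this is a
    [B]-linear lifting of [f], so [M] is projective.

    The elementwise consequence of perfectness that enters is that each [x]
    satisfies [x ^+ k = x ^+ k.+1 * a] for some [k] and [a]
    ([perfect_pi_regular]): the localization [A[1/x]] is flat, hence a direct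
    summand of the module of sequences that are eventually geometric of
    ratio [x], and reading off one entry of the image of [1] gives the
    equation.

    These two meet in total quotient rings. Assume that [Q(R)] is perfect and
    that non-zero-divisors of [R] divide non-zero-divisors coming from [S]. An
    equation as above for a non-zero-divisor [x] of [S], written with a
    denominator [t] from [S], reads [x ^+ k * t = x ^+ k.+1 * a] with [a] in
    [R]; the retraction makes [a] an element of [S], so [x] divides [t] and
    stays a non-zero-divisor in [R] ([nzd_extend]). Consequently [Q(S)] maps
    to [Q(R)], the retraction extends to fractions, and [Q(S)] is perfect.
    Applied to [S/(xs)] and [R/(xs)], this shows by induction that regular
    sequences of [S] are regular in [R] and that [S] is regularly subperfect.
    A maximal regular sequence of [S] is maximal in [R], because an element of
    [R] that extends it can be replaced by a multiple lying in [S]; so its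
    length is the one prescribed by [R]. *)

(** * Tensor products as abelian groups *)

Section TensorGroup.
Variables (A : comPzRingType) (M N : lmodType A).
Implicit Types (x y : tensor M N) (s t : seq (M * N)).

Definition tensor_add x y : tensor M N := tensor_pi (repr x ++ repr y).
Definition tensor_opp : tensor M N -> tensor M N :=
  tensor_map (-%R : {linear N -> N}).

Lemma tensor_ind (P : tensor M N -> Prop) :
  (forall s, P (tensor_pi s)) -> forall x, P x.
Proof. by move=> h x; rewrite -[x]tensor_pi_repr. Qed.

Lemma tensor_add_pi s t :
  tensor_add (tensor_pi s) (tensor_pi t) = tensor_pi (s ++ t).
Proof.
by apply/tensor_piP/tensor_cat; apply/tensor_piP; rewrite tensor_pi_repr.
Qed.

Fact tensor_addA : associative tensor_add.
Proof.
elim/tensor_ind=> s; elim/tensor_ind=> t; elim/tensor_ind=> u.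
by rewrite !tensor_add_pi catA.
Qed.

Fact tensor_addC : commutative tensor_add.
Proof.
elim/tensor_ind=> s; elim/tensor_ind=> t; rewrite !tensor_add_pi.
exact/tensor_piP/tensor_catC.
Qed.

Fact tensor_add0 : left_id (tensor_pi [::]) tensor_add.
Proof. by elim/tensor_ind=> s; rewrite tensor_add_pi. Qed.

HB.instance Definition _ := GRing.isNmodule.Build (tensor M N)
  tensor_addA tensor_addC tensor_add0.

Lemma tensor_pi_cat s t : tensor_pi (s ++ t) = tensor_pi s + tensor_pi t.
Proof. by rewrite [RHS]tensor_add_pi. Qed.

Lemma pure_opp m n :
  tensor_pi [:: (m, - n)] + tensor_pi [:: (m, n)] = 0 :> tensor M N.
Proof.
rewrite -tensor_pi_cat; apply/tensor_piP.
apply: tensor_trans (tensor_sym (tensor_addr m (- n) n)) _.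
rewrite addNr -(scale0r (0 : N)).
apply: tensor_trans (tensor_sym (tensor_scale _ _ _)) _.
by rewrite scale0r; exact: tensor_zero.
Qed.

Fact tensor_addN : left_inverse 0 tensor_opp +%R.
Proof.
elim/tensor_ind=> s; rewrite /tensor_opp tensor_mapE.
elim: s => [|[m n] s IH]; first by rewrite -tensor_pi_cat.
rewrite /= -cat1s -(cat1s (m, n)) !tensor_pi_cat addrACA IH addr0.
exact: pure_opp.
Qed.

HB.instance Definition _ :=
  GRing.Nmodule_isZmodule.Build (tensor M N) tensor_addN.

Definition pure (m : M) (n : N) : tensor M N := tensor_pi [:: (m, n)].

Lemma tensor_pi_sum s : tensor_pi s = \sum_(p <- s) pure p.1 p.2.
Proof.
elim: s => [|[m n] s IH]; first by rewrite big_nil.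
by rewrite big_cons -IH [RHS]tensor_add_pi.
Qed.

Lemma pureDl n : {morph pure^~ n : m m' / m + m'}.
Proof.
by move=> m m'; rewrite [RHS]tensor_add_pi; apply/tensor_piP;
  exact: tensor_addl.
Qed.

Lemma pureDr m : {morph pure m : n n' / n + n'}.
Proof.
by move=> n n'; rewrite [RHS]tensor_add_pi; apply/tensor_piP;
  exact: tensor_addr.
Qed.

Lemma pureZ a m n : pure (a *: m) n = pure m (a *: n).
Proof. exact/tensor_piP/tensor_scale. Qed.

Lemma pure_ind (P : tensor M N -> Prop) :
  P 0 -> (forall m n, P (pure m n)) ->
  (forall x y, P x -> P y -> P (x + y)) -> forall x, P x.
Proof.
move=> P0 P1 PD; elim/tensor_ind=> s; rewrite tensor_pi_sum.
by elim/big_ind: _.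
Qed.

(** The universal property for maps into abelian groups. *)
Section Lift.
Variables (T : zmodType) (beta : M -> N -> T).

Definition balanced :=
  [/\ forall n, {morph beta^~ n : m m' / m + m'},
      forall m, {morph beta m : n n' / n + n'}
    & forall a m n, beta (a *: m) n = beta m (a *: n)].

Definition tensor_lift x : T := \sum_(p <- repr x) beta p.1 p.2.

Hypothesis betaB : balanced.

Lemma balanced_rel s t : tensor_rel s t ->
  \sum_(p <- s) beta p.1 p.2 = \sum_(p <- t) beta p.1 p.2.
Proof.
case: betaB => Dl Dr Z; elim=> {s t} //=.
- by move=> s t u _ -> _ ->.
- by move=> s s' t t' _ hs _ ht; rewrite !big_cat /= hs ht.
- by move=> s t; rewrite !big_cat /= addrC.
- move=> n; rewrite big_seq1 big_nil /=.
  by apply: (addrI (beta 0 n)); rewrite -Dl !addr0.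
- by move=> m m' n; rewrite big_seq1 big_cons big_seq1 /= Dl.
- by move=> m n n'; rewrite big_seq1 big_cons big_seq1 /= Dr.
- by move=> a m n; rewrite !big_seq1 /= Z.
Qed.

Lemma tensor_liftE s : tensor_lift (tensor_pi s) = \sum_(p <- s) beta p.1 p.2.
Proof. by apply/balanced_rel/tensor_piP; rewrite tensor_pi_repr. Qed.

Lemma tensor_lift_pure m n : tensor_lift (pure m n) = beta m n.
Proof. by rewrite tensor_liftE big_seq1. Qed.

Lemma tensor_liftD : {morph tensor_lift : x y / x + y}.
Proof.
elim/tensor_ind=> s; elim/tensor_ind=> t.
by rewrite [_ + _]tensor_add_pi !tensor_liftE big_cat.
Qed.

Lemma tensor_lift0 : tensor_lift 0 = 0.
Proof. by rewrite tensor_liftE big_nil. Qed.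

End Lift.
End TensorGroup.

Section TensorMap.
Variables (A : comPzRingType) (M N N' : lmodType A) (f : {linear N -> N'}).

Lemma tensor_map_pure (m : M) n : tensor_map f (pure m n) = pure m (f n).
Proof. by rewrite tensor_mapE. Qed.

Lemma tensor_mapD : {morph @tensor_map A M N N' f : x y / x + y}.
Proof.
elim/tensor_ind=> s; elim/tensor_ind=> t.
by rewrite -tensor_pi_cat !tensor_mapE -tensor_pi_cat -map_cat.
Qed.

Lemma tensor_map0 : @tensor_map A M N N' f 0 = 0.
Proof. exact: tensor_mapE. Qed.

End TensorMap.

(** * Restriction of scalars and base change *)

(** The morphism occurs in no component, but the module structure over [B] is
    found through it. *)
Definition restr (B A : comPzRingType) (i : {rmorphism B -> A})
  (N : lmodType A) : Type := N.

Definition restr_map (B A : comPzRingType) (i : {rmorphism B -> A})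
  (N N' : lmodType A) (f : {linear N -> N'}) : restr i N -> restr i N' := f.
Arguments restr_map {B A} i {N N'} f.

Section RestrictionOfScalars.
Variables (B A : comPzRingType) (i : {rmorphism B -> A}).

Section Module.
Variable N : lmodType A.

HB.instance Definition _ := GRing.Zmodule.on (restr i N).

Definition restr_scale (b : B) (n : restr i N) : restr i N := i b *: (n : N).

Fact restr_scaleA b b' n :
  restr_scale b (restr_scale b' n) = restr_scale (b * b') n.
Proof. by rewrite /restr_scale scalerA rmorphM. Qed.

Fact restr_scale1 : left_id 1 restr_scale.
Proof. by move=> n; rewrite /restr_scale rmorph1 scale1r. Qed.

Fact restr_scaleDr : right_distributive restr_scale +%R.
Proof. by move=> b n n'; exact: scalerDr. Qed.

Fact restr_scaleDl n : {morph restr_scale^~ n : b b' / b + b'}.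
Proof. by move=> b b'; rewrite /restr_scale rmorphD scalerDl. Qed.

HB.instance Definition _ := GRing.Zmodule_isLmodule.Build B (restr i N)
  restr_scaleA restr_scale1 restr_scaleDr restr_scaleDl.

Lemma restr_scaleE b (n : restr i N) : b *: n = i b *: (n : N) :> N.
Proof. by []. Qed.

End Module.

Fact restr_map_linear (N N' : lmodType A) (f : {linear N -> N'}) :
  linear (restr_map i f).
Proof. by move=> b n n'; rewrite /restr_map linearP. Qed.

HB.instance Definition _ (N N' : lmodType A) (f : {linear N -> N'}) :=
  GRing.isLinear.Build B (restr i N) (restr i N') *:%R (restr_map i f)
    (@restr_map_linear N N' f).

End RestrictionOfScalars.

Section BaseChange.
Variables (B A : comPzRingType) (i : {rmorphism B -> A}).

Definition base_change (M : lmodType B) : Type := tensor M (restr i A^o).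

Section Module.
Variable M : lmodType B.

HB.instance Definition _ := GRing.Zmodule.on (base_change M).

Definition tens (m : M) (a : A) : base_change M := @pure B M (restr i A^o) m a.

Lemma tensDl a : {morph tens^~ a : m m' / m + m'}.
Proof. exact: pureDl. Qed.

Lemma tensDr m : {morph tens m : a a' / a + a'}.
Proof. exact: (@pureDr B M (restr i A^o) m). Qed.

Lemma tensZ b m a : tens (b *: m) a = tens m (i b * a).
Proof. exact: pureZ. Qed.

Lemma tens_ind (P : base_change M -> Prop) :
  P 0 -> (forall m a, P (tens m a)) ->
  (forall x y, P x -> P y -> P (x + y)) -> forall x, P x.
Proof. exact: (@pure_ind B M (restr i A^o) P). Qed.

Section Lift.
Variables (T : zmodType) (beta : M -> A -> T).

Definition tens_lift (x : base_change M) : T :=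
  @tensor_lift B M (restr i A^o) T beta x.

Hypothesis betaDl : forall a, {morph beta^~ a : m m' / m + m'}.
Hypothesis betaDr : forall m, {morph beta m : a a' / a + a'}.
Hypothesis betaZ : forall b m a, beta (b *: m) a = beta m (i b * a).

Let betaB : @balanced B M (restr i A^o) T beta. Proof. by split. Qed.

Lemma tens_lift_tens m a : tens_lift (tens m a) = beta m a.
Proof. exact: tensor_lift_pure. Qed.

Lemma tens_liftD : {morph tens_lift : x y / x + y}.
Proof. exact: tensor_liftD. Qed.

Lemma tens_lift0 : tens_lift 0 = 0.
Proof. exact: tensor_lift0. Qed.

End Lift.

Definition base_change_scale (c : A) : base_change M -> base_change M :=
  tens_lift (fun m a => tens m (c * a)).

Fact bc_scale_tens c m a : base_change_scale c (tens m a) = tens m (c * a).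
Proof.
apply: tens_lift_tens => [a1|m1|b m1 a1] => [m2 m3|a2 a3|].
- by rewrite tensDl.
- by rewrite mulrDr tensDr.
- by rewrite tensZ mulrCA.
Qed.

Fact bc_scaleDr : right_distributive base_change_scale +%R.
Proof.
move=> c x y; apply: tens_liftD => [a1|m1|b m1 a1] => [m2 m3|a2 a3|].
- by rewrite tensDl.
- by rewrite mulrDr tensDr.
- by rewrite tensZ mulrCA.
Qed.

Fact bc_scale0 c : base_change_scale c 0 = 0.
Proof.
by apply: (addrI (base_change_scale c 0)); rewrite -bc_scaleDr !addr0.
Qed.

Fact bc_scaleA c d x :
  base_change_scale c (base_change_scale d x) = base_change_scale (c * d) x.
Proof.
elim/tens_ind: x => [|m a|x y hx hy]; first by rewrite !bc_scale0.
  by rewrite !bc_scale_tens mulrA.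
by rewrite !bc_scaleDr hx hy.
Qed.

Fact bc_scale1 : left_id 1 base_change_scale.
Proof.
elim/tens_ind=> [|m a|x y hx hy]; first by rewrite bc_scale0.
  by rewrite bc_scale_tens mul1r.
by rewrite bc_scaleDr hx hy.
Qed.

Fact bc_scaleDl x : {morph base_change_scale^~ x : c d / c + d}.
Proof.
move=> c d; elim/tens_ind: x => [|m a|x y hx hy].
- by rewrite !bc_scale0 addr0.
- by rewrite !bc_scale_tens mulrDl tensDr.
- by rewrite !bc_scaleDr hx hy addrACA.
Qed.

HB.instance Definition _ := GRing.Zmodule_isLmodule.Build A (base_change M)
  bc_scaleA bc_scale1 bc_scaleDr bc_scaleDl.

Lemma scale_tens c m a : c *: tens m a = tens m (c * a).
Proof. exact: bc_scale_tens. Qed.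

End Module.

Section Map.
Variables (M M' : lmodType B) (f : {linear M -> M'}).

Definition base_change_map : base_change M -> base_change M' :=
  tens_lift (fun m a => tens (f m) a).

Let balDl a : {morph (fun m a => tens (f m) a)^~ a : m m' / m + m'}.
Proof. by move=> m m'; rewrite raddfD tensDl. Qed.
Let balDr m : {morph (fun a => tens (f m) a) : a a' / a + a'}.
Proof. exact: tensDr. Qed.
Let balZ b m a : tens (f (b *: m)) a = tens (f m) (i b * a).
Proof. by rewrite linearZ tensZ. Qed.

Lemma base_change_map_tens m a : base_change_map (tens m a) = tens (f m) a.
Proof. exact: (tens_lift_tens balDl balDr balZ). Qed.

Fact base_change_mapD : {morph base_change_map : x y / x + y}.
Proof. exact: (tens_liftD balDl balDr balZ). Qed.

Fact base_change_map_linear : linear base_change_map.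
Proof.
move=> c x y; rewrite base_change_mapD; congr (_ + _).
have map0 : base_change_map 0 = 0 by exact: (tens_lift0 balDl balDr balZ).
elim/tens_ind: x => [|m a|x1 x2 h1 h2]; first by rewrite scaler0 map0 scaler0.
  by rewrite scale_tens !base_change_map_tens scale_tens.
by rewrite scalerDr !base_change_mapD h1 h2 scalerDr.
Qed.

HB.instance Definition _ :=
  GRing.isLinear.Build A (base_change M) (base_change M') *:%R base_change_map
    base_change_map_linear.

Lemma base_change_map_surj :
  (forall y, exists x, f x = y) -> forall y, exists x, base_change_map x = y.
Proof.
move=> fS; elim/tens_ind=> [|m a|_ _ [x1 <-] [x2 <-]].
- by exists 0; rewrite raddf0.
- by have [m' <-] := fS m; exists (tens m' a); rewrite base_change_map_tens.
- by exists (x1 + x2); rewrite raddfD.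
Qed.

End Map.

(** The two maps of the isomorphism between [(M (x)_B A) (x)_A N] and
    [M (x)_B N]. Flatness of base changes rests on [contract] being natural in
    [N] and having [expand] as a left inverse. *)
Section Contract.
Variables (M : lmodType B) (N : lmodType A).

Definition contract2 (n : N) : base_change M -> tensor M (restr i N) :=
  tens_lift (fun m (a : A) => @pure B M (restr i N) m (a *: n)).

Let balDl (n : N) (a : A) :
  {morph (fun m => @pure B M (restr i N) m (a *: n)) : m m' / m + m'}.
Proof. exact: pureDl. Qed.
Let balDr (n : N) m :
  {morph (fun a : A => @pure B M (restr i N) m (a *: n)) : a a' / a + a'}.
Proof. by move=> a a'; rewrite scalerDl (@pureDr B M (restr i N)). Qed.
Let balZ (n : N) b m (a : A) :
  @pure B M (restr i N) (b *: m) (a *: n) =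
  @pure B M (restr i N) m ((i b * a) *: n).
Proof. by rewrite pureZ restr_scaleE scalerA. Qed.

Fact contract2_tens n m a :
  contract2 n (tens m a) = @pure B M (restr i N) m (a *: n).
Proof. exact: (tens_lift_tens (balDl n) (balDr n) (balZ n)). Qed.

Fact contract2D n : {morph contract2 n : x y / x + y}.
Proof. exact: (tens_liftD (balDl n) (balDr n) (balZ n)). Qed.

Fact contract20 n : contract2 n 0 = 0.
Proof. exact: (tens_lift0 (balDl n) (balDr n) (balZ n)). Qed.

Fact contract2_balanced :
  @balanced A (base_change M) N _ (fun x n => contract2 n x).
Proof.
split=> [n|x|c x n]; first exact: contract2D.
- move=> n n'; elim/tens_ind: x => [|m a|x y hx hy].
  + by rewrite !contract20 addr0.
  + by rewrite !contract2_tens scalerDr pureDr.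
  + by rewrite !contract2D hx hy addrACA.
- elim/tens_ind: x => [|m a|x y hx hy]; first by rewrite scaler0 !contract20.
  + by rewrite scale_tens !contract2_tens scalerA mulrC.
  + by rewrite scalerDr !contract2D hx hy.
Qed.

Definition contract : tensor (base_change M) N -> tensor M (restr i N) :=
  tensor_lift (fun x n => contract2 n x).

Definition expand : tensor M (restr i N) -> tensor (base_change M) N :=
  tensor_lift (fun m (n : restr i N) => pure (tens m 1) (n : N)).

Fact expand_balanced : @balanced B M (restr i N) _
  (fun m (n : restr i N) => @pure A (base_change M) N (tens m 1) (n : N)).
Proof.
split=> [n m m'|m n n'|b m n]; first by rewrite tensDl pureDl.
  exact: pureDr.
by rewrite tensZ -scale_tens pureZ restr_scaleE.
Qed.

Lemma contractK : cancel contract expand.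
Proof.
have CD := tensor_liftD contract2_balanced.
have C0 := tensor_lift0 contract2_balanced.
have ED := tensor_liftD expand_balanced.
have E0 := tensor_lift0 expand_balanced.
elim/pure_ind=> [|x n|x y hx hy]; rewrite /contract /expand.
- by rewrite C0 E0.
- rewrite (tensor_lift_pure contract2_balanced).
  elim/tens_ind: x => [|m a|x y hx hy].
  + rewrite contract20 E0 -(scale0r 0) pureZ scale0r.
    by apply: (addrI (pure 0 0)); rewrite -pureDr !addr0.
  + rewrite contract2_tens (tensor_lift_pure expand_balanced) -pureZ.
    by rewrite scale_tens mulr1.
  + by rewrite contract2D ED hx hy pureDl.
- by rewrite CD ED; congr (_ + _).
Qed.

End Contract.

Lemma contract_natural (M : lmodType B) (N N' : lmodType A)
    (f : {linear N -> N'}) (x : tensor (base_change M) N) :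
  contract (tensor_map f x) =
  @tensor_map B M (restr i N) (restr i N') (restr_map i f) (contract x).
Proof.
have CD N1 := tensor_liftD (@contract2_balanced M N1).
have C0 N1 := tensor_lift0 (@contract2_balanced M N1).
rewrite /contract; elim/pure_ind: x => [|x n|x y hx hy].
- by rewrite tensor_map0 !C0 tensor_map0.
- rewrite tensor_map_pure !(tensor_lift_pure (@contract2_balanced _ _)).
  elim/tens_ind: x => [|m a|x y hx hy].
  + by rewrite !contract20 tensor_map0.
  + rewrite !contract2_tens tensor_map_pure; congr (pure m _).
    exact: (esym (linearZ_LR f a n)).
  + by rewrite !contract2D hx hy tensor_mapD.
- by rewrite tensor_mapD !CD hx hy tensor_mapD.
Qed.

(** Tensoring [M (x)_B A] over [A] is tensoring [M] over [B]. *)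
Lemma flat_base_change (M : lmodType B) : flat M -> flat (base_change M).
Proof.
move=> Mflat N N' f f_inj x y fxy; apply: (can_inj (@contractK M N)).
apply: (Mflat (restr i N) (restr i N') (restr_map i f) f_inj
  (contract x) (contract y) _).
by rewrite -!contract_natural fxy.
Qed.

(** * Descent of perfectness along split morphisms *)

Section Retraction.
Variable r : {additive A -> B}.
Hypothesis r_linear : forall b a, r (i b * a) = b * r a.
Hypothesis r1 : r 1 = 1.

Section Evaluation.
Variable M : lmodType B.

Definition retract : base_change M -> M := tens_lift (fun m a => r a *: m).

Let balDl a : {morph (fun m : M => r a *: m) : m m' / m + m'}.
Proof. exact: scalerDr. Qed.
Let balDr (m : M) : {morph (fun a => r a *: m) : a a' / a + a'}.
Proof. by move=> a a'; rewrite raddfD scalerDl. Qed.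
Let balZ b (m : M) a : r a *: (b *: m) = r (i b * a) *: m.
Proof. by rewrite r_linear scalerA mulrC. Qed.

Lemma retract_tens m a : retract (tens m a) = r a *: m.
Proof. exact: (tens_lift_tens balDl balDr balZ). Qed.

Lemma retractD : {morph retract : x y / x + y}.
Proof. exact: (tens_liftD balDl balDr balZ). Qed.

Lemma retract0 : retract 0 = 0.
Proof. exact: (tens_lift0 balDl balDr balZ). Qed.

Lemma retractZ b x : retract (i b *: x) = b *: retract x.
Proof.
elim/tens_ind: x => [|m a|x y hx hy]; first by rewrite scaler0 retract0 scaler0.
  by rewrite scale_tens !retract_tens r_linear scalerA.
by rewrite scalerDr !retractD hx hy scalerDr.
Qed.

End Evaluation.

Lemma retract_natural (M M' : lmodType B) (f : {linear M -> M'}) x :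
  retract (base_change_map f x) = f (retract x).
Proof.
elim/tens_ind: x => [|m a|x y hx hy]; first by rewrite raddf0 !retract0 raddf0.
  by rewrite base_change_map_tens !retract_tens linearZ.
by rewrite raddfD !retractD hx hy raddfD.
Qed.

(** A lifting over [A] of the base changed problem is turned into a lifting
    over [B] by applying the retraction to its values on the [m (x) 1]. *)
Lemma projective_descent (M : lmodType B) :
  projective (base_change M) -> projective M.
Proof.
move=> Mproj N P g f g_surj.
have [h hP] := Mproj _ _ (base_change_map g) (base_change_map f)
  (base_change_map_surj g_surj).
pose h' m := retract (h (tens m 1)).
have h'L : linear h'.
  move=> b m m'; rewrite /h' tensDl raddfD retractD; congr (_ + _).
  rewrite tensZ -scale_tens -retractZ; congr retract.
  exact: (linearZ_LR h).
pose H : {linear M -> N} :=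
  HB.pack h' (GRing.isLinear.Build B M N *:%R h' h'L).
exists H => m; rewrite /= /h' -retract_natural hP /= base_change_map_tens.
by rewrite retract_tens r1 scale1r.
Qed.

Theorem perfect_descent : perfect A -> perfect B.
Proof.
by move=> Aperf M Mflat; apply/projective_descent/Aperf/flat_base_change.
Qed.

End Retraction.

End BaseChange.

(** * Powers of an element of a perfect ring *)

Section Localization.
Variables (A : comPzRingType) (x : A).
Local Open Scope quotient_scope.

Definition eventually (P : nat -> Prop) :=
  exists K, forall j, (K <= j)%N -> P j.

Lemma eventually_all (P : nat -> Prop) : (forall j, P j) -> eventually P.
Proof. by move=> h; exists 0%N. Qed.

Lemma eventually2 (P Q S : nat -> Prop) :
  (forall j, P j -> Q j -> S j) -> eventually P -> eventually Q -> eventually S.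
Proof.
move=> PQS [K hK] [L hL]; exists (maxn K L) => j.
rewrite geq_max => /andP[Kj Lj].
by apply: PQS; [exact: hK | exact: hL].
Qed.

Lemma eventually1 (P S : nat -> Prop) :
  (forall j, P j -> S j) -> eventually P -> eventually S.
Proof.
by move=> PS; apply: (fun e => eventually2 (fun j p _ => PS j p) e e).
Qed.

(** Sequences [h] for which [h j / x ^+ j] is eventually constant in [A[1/x]].
    Through [h |-> (h 0, h 1 - x * h 0, h 2 - x * h 1, ..)] they form a free
    module, a cover of [A[1/x]] in which a power of [x] dividing a sequence
    visibly divides every entry. *)
Definition geometric : {pred nat -> A^o} :=
  fun h => `[< eventually (fun j => h j.+1 = x * h j) >].

Fact geometric_submod_closed : submod_closed geometric.
Proof.
split=> [|a u v /asboolP hu /asboolP hv]; apply/asboolP.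
  by apply: eventually_all => j; rewrite mulr0.
apply: eventually2 hu hv => j hu hv.
by rewrite !fctE hu hv mulrDr; congr (_ + _); rewrite [LHS]mulrCA.
Qed.

HB.instance Definition _ :=
  GRing.isSubmodClosed.Build A (nat -> A^o) geometric geometric_submod_closed.

Record geom := Geom { geom_val :> nat -> A^o; _ : geom_val \in geometric }.

HB.instance Definition _ := [isSub for geom_val].
HB.instance Definition _ := [Choice of geom by <:].
HB.instance Definition _ :=
  GRing.SubChoice_isSubLmodule.Build A (nat -> A^o) geometric geom
    geometric_submod_closed.

Definition negligible : {pred geom} :=
  fun h => `[< eventually (fun j => h j = 0) >].

Fact negligible_zmod_closed : zmod_closed negligible.
Proof.
split=> [|u v /asboolP hu /asboolP hv]; apply/asboolP.
  exact: eventually_all.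
by apply: eventually2 hu hv => j; rewrite /= !fctE => -> ->; rewrite subr0.
Qed.

HB.instance Definition _ :=
  GRing.isZmodClosed.Build geom negligible negligible_zmod_closed.

(** The localization [A[1/x]]: the class of [h] is the eventual value of
    [h j / x ^+ j]. *)
Definition loc : Type := Quotient.quot negligible.
HB.instance Definition _ := GRing.Zmodule.on loc.
HB.instance Definition _ := EqQuotient.on loc.

Definition loc_pi (h : geom) : loc := \pi_(Quotient.quot negligible) h.

Lemma loc_piP h k : loc_pi h = loc_pi k <-> eventually (fun j => h j = k j).
Proof.
have -> : loc_pi h = loc_pi k <-> h - k \in negligible.
  by rewrite Quotient.idealrBE; split=> [e|/eqP e]; [apply/eqP|]; exact: e.
split=> [/asboolP|e]; last apply/asboolP.
  apply: eventually1 => j; rewrite /= !fctE => /eqP.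
  by rewrite subr_eq0 => /eqP.
by apply: eventually1 e => j; rewrite /= !fctE => ->; rewrite subrr.
Qed.

Lemma loc_pi_repr q : loc_pi (repr q) = q. Proof. exact: reprK. Qed.

Fact loc_piB : zmod_morphism loc_pi.
Proof. by move=> h k; rewrite /loc_pi raddfB. Qed.
HB.instance Definition _ := GRing.isZmodMorphism.Build geom loc loc_pi loc_piB.

Definition loc_scale (a : A) (q : loc) : loc := loc_pi (a *: repr q).

Fact loc_scale_pi a h : loc_scale a (loc_pi h) = loc_pi (a *: h).
Proof.
have /loc_piP e := loc_pi_repr (loc_pi h).
by apply/loc_piP; apply: eventually1 e => j; rewrite /= !fctE => ->.
Qed.

Lemma loc_ind (P : loc -> Prop) : (forall h, P (loc_pi h)) -> forall q, P q.
Proof. by move=> h q; rewrite -[q]loc_pi_repr. Qed.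

Fact loc_scaleA a b q : loc_scale a (loc_scale b q) = loc_scale (a * b) q.
Proof. by elim/loc_ind: q => h; rewrite !loc_scale_pi scalerA. Qed.
Fact loc_scale1 : left_id 1 loc_scale.
Proof. by elim/loc_ind=> h; rewrite loc_scale_pi scale1r. Qed.
Fact loc_scaleDr : right_distributive loc_scale +%R.
Proof.
move=> a; elim/loc_ind=> h; elim/loc_ind=> k.
by rewrite -raddfD !loc_scale_pi scalerDr raddfD.
Qed.
Fact loc_scaleDl q : {morph loc_scale^~ q : a b / a + b}.
Proof.
by move=> a b; elim/loc_ind: q => h; rewrite !loc_scale_pi scalerDl raddfD.
Qed.

HB.instance Definition _ := GRing.Zmodule_isLmodule.Build A loc
  loc_scaleA loc_scale1 loc_scaleDr loc_scaleDl.

Fact loc_pi_linear : linear loc_pi.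
Proof. by move=> a h k; rewrite raddfD /= -loc_scale_pi. Qed.
HB.instance Definition _ :=
  GRing.isLinear.Build A geom loc *:%R loc_pi loc_pi_linear.

(** The entries depend on the chosen representative; only statements about
    large indices are meaningful, whence the use of [eventually]. *)
Definition germ (q : loc) : nat -> A := repr q.

Lemma germ_pi h : eventually (fun j => germ (loc_pi h) j = h j).
Proof. by apply/loc_piP; rewrite loc_pi_repr. Qed.

Lemma germD q r : eventually (fun j => germ (q + r) j = germ q j + germ r j).
Proof.
apply: eventually1 (germ_pi (repr q + repr r)) => j.
by rewrite raddfD /= !loc_pi_repr.
Qed.

Lemma germ0 : eventually (fun j => germ 0 j = 0).
Proof. by apply: eventually1 (germ_pi 0) => j; rewrite raddf0. Qed.

Lemma germZ a q : eventually (fun j => germ (a *: q) j = a * germ q j).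
Proof. exact: (germ_pi (a *: repr q)). Qed.

(** Represents [x ^- k], the constant value of [x ^+ (j - k) / x ^+ j]. *)
Definition inv_pow_seq (k : nat) : nat -> A :=
  fun j => if (k <= j)%N then x ^+ (j - k) else 0.

Fact inv_pow_geometric k : inv_pow_seq k \in geometric.
Proof.
apply/asboolP; exists k => j kj.
by rewrite /inv_pow_seq kj leqW // subSn // exprS.
Qed.

Definition inv_pow k : loc := loc_pi (Geom (inv_pow_geometric k)).

Lemma inv_powE k l : x ^+ l *: inv_pow (k + l) = inv_pow k.
Proof.
rewrite /inv_pow -linearZ; apply/loc_piP; exists (k + l)%N => j klj /=.
rewrite !fctE /= /inv_pow_seq klj (leq_trans (leq_addr l k) klj).
rewrite [LHS](esym (exprD _ _ _)) subnDA subnKC // leq_subRL //.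
exact: leq_trans (leq_addr l k) klj.
Qed.

(** Every [k] large enough is the exponent of a denominator of [q], with
    numerator the [k]-th entry of any representative. *)
Lemma germ_inv_pow q : eventually (fun k => q = germ q k *: inv_pow k).
Proof.
have [/= h /asboolP[K hK] eqh] :
    exists2 h : geom, (h : nat -> A) \in geometric & h = repr q.
  by exists (repr q) => //; case: (repr q).
exists K => k Kk; rewrite -{1}[q]loc_pi_repr /inv_pow -linearZ /germ -eqh.
apply/loc_piP; exists k => j kj; rewrite /= !fctE /inv_pow_seq kj.
rewrite -{1}(subnKC kj); elim: (j - k)%N => [|d IH].
  by rewrite addn0 expr0 [RHS]mulr1.
by rewrite addnS hK ?IH ?(leq_trans Kk) ?leq_addr // exprS [RHS]mulrCA.
Qed.

Section Flat.
Variable N : lmodType A.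
Implicit Types s t : seq (loc * N).

(** For [j] large, [x ^+ j] is a common denominator of the tensor represented
    by [s], and this is the numerator. *)
Definition numer s (j : nat) : N := \sum_(p <- s) germ p.1 j *: p.2.

Lemma numer_rel s t :
  tensor_rel s t -> eventually (fun j => numer s j = numer t j).
Proof.
elim=> {s t}; rewrite /numer.
- by move=> s; exact: eventually_all.
- by move=> s t _; apply: eventually1 => j ->.
- by move=> s t u _ st _ tu; apply: eventually2 st tu => j -> ->.
- move=> s s' t t' _ hs _ ht; apply: eventually2 hs ht => j hs ht.
  by rewrite !big_cat /= hs ht.
- by move=> s t; apply: eventually_all => j; rewrite !big_cat /= addrC.
- move=> n; apply: eventually1 germ0 => j g0.
  by rewrite big_seq1 big_nil g0 scale0r.
- move=> m m' n; apply: eventually1 (germD m m') => j gD.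
  by rewrite big_seq1 big_cons big_seq1 gD scalerDl.
- move=> m n n'; apply: eventually_all => j.
  by rewrite big_seq1 big_cons big_seq1 scalerDr.
- move=> a m n; apply: eventually1 (germZ a m) => j gZ.
  by rewrite !big_seq1 gZ scalerA mulrC.
Qed.

Lemma pure_numer s :
  eventually (fun k => tensor_pi s = pure (inv_pow k) (numer s k)).
Proof.
elim: s => [|[m n] s IH].
  apply: eventually_all => k; rewrite /numer big_nil.
  by apply: (addrI (pure (inv_pow k) 0)); rewrite -pureDr !addr0.
apply: eventually2 IH (germ_inv_pow m) => k IH hm.
rewrite -cat1s tensor_pi_cat IH /numer big_cons pureDr /= -pureZ.
congr (pure _ _ + _).
exact: hm.
Qed.

End Flat.

(** Numerators of equal tensors eventually agree; an injective [f] lets this be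
    tested after applying [f], and agreement of numerators gives back equality
    of the tensors. *)
Lemma flat_loc : flat loc.
Proof.
move=> N N' f f_inj; elim/tensor_ind=> s; elim/tensor_ind=> t.
rewrite !tensor_mapE => /tensor_piP/numer_rel.
have numer_map u j : numer (tensor_map_seq f u) j = f (numer u j).
  rewrite /numer big_map raddf_sum; apply: eq_bigr => p _.
  exact: (esym (linearZ_LR f _ _)).
move=> e; have {e}e : eventually (fun j => numer s j = numer t j).
  by apply: eventually1 e => j; rewrite !numer_map => /f_inj.
have [K hK] := eventually2 (fun j => @conj _ _) e
  (eventually2 (fun j => @conj _ _) (pure_numer s) (pure_numer t)).
by have [eK [-> ->]] := hK K (leqnn K); rewrite eK.
Qed.

End Localization.

(** A section [h] of [loc_pi] sends [1] to a sequence whose [L]-th entry is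
    [x ^+ L] for [L] large. As [1 = x ^+ L.+1 * x ^- L.+1], this sequence is
    also a multiple of [x ^+ L.+1]. *)
Theorem perfect_pi_regular (A : comPzRingType) (x : A) :
  perfect A -> exists k a, x ^+ k = x ^+ k.+1 * a.
Proof.
move=> Aperf.
have [] := Aperf _ (@flat_loc A x) _ _ (@loc_pi A x) idfun.
  by move=> q; exists (repr q); exact: loc_pi_repr.
move=> h hP.
have /loc_piP[L hL] : loc_pi (h (inv_pow x 0)) = inv_pow x 0 by exact: hP.
exists L, (geom_val (h (inv_pow x L.+1)) L).
have := hL L (leqnn L); rewrite /= /inv_pow_seq /= subn0 => <-.
by rewrite -(inv_powE x 0 L.+1) linearZ.
Qed.

(** * Total quotient rings of split extensions *)

Section SplitTotalQuotient.
Variables (S R : comPzRingType).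
Variables (i : {rmorphism S -> R}) (r : {additive R -> S}).
Hypothesis r_linear : forall b a, r (i b * a) = b * r a.
Hypothesis r1 : r 1 = 1.
Hypothesis denominators : forall s : R, s \in @nzd R ->
  exists t c, i t = s * c /\ i t \in @nzd R.
Hypothesis Rsub : perfect (total_quot R).
Local Notation frac := Defs.frac.

Lemma retractionK : cancel i r.
Proof. by move=> b; rewrite -[i b]mulr1 r_linear r1 mulr1. Qed.

Lemma nzd_factor (A : comPzRingType) (s t : A) :
  s * t \in @nzd A -> s \in @nzd A.
Proof.
move=> /asboolP stP; apply/asboolP => a sa0; apply: stP.
by rewrite mulrAC sa0 mul0r.
Qed.

Lemma nzd_descend t : i t \in @nzd R -> t \in @nzd S.
Proof.
move=> /asboolP itP; apply/asboolP => a ta0; apply: (can_inj retractionK).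
by rewrite rmorph0; apply: itP; rewrite -rmorphM ta0 rmorph0.
Qed.

Lemma frac_exp (A : comPzRingType) (a : A) k :
  frac a (nzd1 A) ^+ k = frac (a ^+ k) (nzd1 A).
Proof.
elim: k => [//|k IH]; rewrite !exprS IH [LHS]frac_mul.
by apply/fracP; rewrite !mulr1.
Qed.

(** In [Q(R)] some power of [x] is a multiple of the next one. After clearing
    denominators with an element [t] of [S] and retracting to [S], the powers
    of [x] cancel there and leave [t] as a multiple of [x]. *)
Lemma nzd_extend x : x \in @nzd S -> i x \in @nzd R.
Proof.
move=> xP; have [k [q]] := perfect_pi_regular (frac (i x) (nzd1 R)) Rsub.
have [a [s [sP ->]]] := fracE q.
rewrite !frac_exp [RHS]frac_mul => /fracP; rewrite mul1r mulr1 => xs.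
have [t [c [tE tP]]] := denominators sP.
(* The factor [r (a * c)] lies in [S], where [x] can be cancelled. *)
have xt : x ^+ k * t = x ^+ k * (x * r (a * c)).
  have /(congr1 r) : i (x ^+ k) * i t = i (x ^+ k.+1) * (a * c).
    by rewrite tE mulrA !rmorphXn xs mulrA.
  by rewrite !r_linear retractionK exprSr mulrA.
have xkP : x ^+ k \in @nzd S.
  by elim: k {xs xt} => [|k IH]; [exact: nzd1 | rewrite exprS; exact: nzdM].
by move: tP; rewrite (nzdI xkP xt) rmorphM => /nzd_factor.
Qed.

Definition frac_map (q : total_quot S) : total_quot R :=
  frac (i (num (repr q))) (nzd_extend (den_nzd (repr q))).

Fact frac_mapE a s (sP : s \in @nzd S) :
  frac_map (frac a sP) = frac (i a) (nzd_extend sP).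
Proof. by apply/fracP; rewrite -!rmorphM repr_frac. Qed.

Fact frac_map_zmod : zmod_morphism frac_map.
Proof.
move=> q q'; case: (fracE q) (fracE q') => a [s [sP ->]] [b [t [tP ->]]].
rewrite [_ - _](_ : _ = tq_add (frac a sP) (tq_opp (frac b tP))) //.
rewrite frac_opp frac_add !frac_mapE.
rewrite [RHS](_ : _ = tq_add (frac (i a) (nzd_extend sP))
                             (tq_opp (frac (i b) (nzd_extend tP)))) //.
by rewrite frac_opp frac_add; apply/fracP; rewrite rmorphD !rmorphM rmorphN.
Qed.

Fact frac_map_monoid : monoid_morphism frac_map.
Proof.
split=> [|q q']; first by rewrite [LHS]frac_mapE; apply/fracP; rewrite rmorph1.
case: (fracE q) (fracE q') => a [s [sP ->]] [b [t [tP ->]]].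
rewrite [_ * _]frac_mul !frac_mapE [RHS]frac_mul.
by apply/fracP; rewrite !rmorphM.
Qed.

HB.instance Definition _ := GRing.isZmodMorphism.Build (total_quot S)
  (total_quot R) frac_map frac_map_zmod.
HB.instance Definition _ := GRing.isMonoidMorphism.Build (total_quot S)
  (total_quot R) frac_map frac_map_monoid.

(** Existence of a single pair, so that one choice provides a numerator in [R]
    together with a denominator from [S] and the proof that it is a
    non-zero-divisor; the latter two are read off a fraction over [S]. *)
Lemma base_denominator (q : total_quot R) :
  exists d : frac_pair S * R, q = frac d.2 (nzd_extend (den_nzd d.1)).
Proof.
have [a [s [sP ->]]] := fracE q; have [t [c [tE tP]]] := denominators sP.
exists (mk_frac 0 (nzd_descend tP), a * c).
by apply/fracP; rewrite /= /den /= tE mulrA mulrAC.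
Qed.

(** Linearity of [r] makes [r a / t] independent of the way in which a fraction
    is written as [a / i t]. *)
Definition frac_retract (q : total_quot R) : total_quot S :=
  let d := sval (cid (base_denominator q)) in frac (r d.2) (den_nzd d.1).

Fact frac_retractE a t (tP : t \in @nzd S) :
  frac_retract (frac a (nzd_extend tP)) = frac (r a) tP.
Proof.
rewrite /frac_retract; case: cid => -[d b] /= /fracP e; apply/fracP.
have /(congr1 r) : i (den d) * a = i t * b by rewrite mulrC e mulrC.
by rewrite !r_linear mulrC [X in _ = X -> _]mulrC => ->.
Qed.

Lemma base_fracE (q : total_quot R) :
  exists a t (tP : t \in @nzd S), q = frac a (nzd_extend tP).
Proof.
have [d ->] := base_denominator q; by exists d.2, (den d.1), (den_nzd d.1).
Qed.

Fact frac_retract_zmod : zmod_morphism frac_retract.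
Proof.
move=> q q'; case: (base_fracE q) (base_fracE q').
move=> a [s [sP ->]] [b [t [tP ->]]].
have -> : frac a (nzd_extend sP) - frac b (nzd_extend tP)
    = frac (a * i t - b * i s) (nzd_extend (nzdM sP tP)).
  rewrite [LHS](_ : _ = tq_add (frac a (nzd_extend sP))
                               (tq_opp (frac b (nzd_extend tP)))) //.
  by rewrite frac_opp frac_add; apply/fracP; rewrite mulNr rmorphM.
rewrite !frac_retractE.
rewrite [RHS](_ : _ = tq_add (frac (r a) sP) (tq_opp (frac (r b) tP))) //.
rewrite frac_opp frac_add; apply/fracP; congr (_ * _).
by rewrite raddfB /= ![_ * i _]mulrC !r_linear mulNr ![_ * r _]mulrC.
Qed.

HB.instance Definition _ := GRing.isZmodMorphism.Build (total_quot R)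
  (total_quot S) frac_retract frac_retract_zmod.

Lemma perfect_total_quot : perfect (total_quot S).
Proof.
apply: (perfect_descent (i := frac_map) (r := frac_retract)) Rsub.
- move=> q q'; case: (fracE q) (base_fracE q') => b [s [sP ->]] [a [t [tP ->]]].
  rewrite /= frac_mapE.
  have -> : frac (i b) (nzd_extend sP) * frac a (nzd_extend tP)
      = frac (i b * a) (nzd_extend (nzdM sP tP)).
    by rewrite [LHS]frac_mul; apply/fracP; rewrite rmorphM.
  by rewrite !frac_retractE r_linear [RHS]frac_mul; apply/fracP.
- have -> : 1 = frac 1 (nzd_extend (nzd1 S)) :> total_quot R.
    by apply/fracP; rewrite rmorph1.
  by rewrite /= frac_retractE r1.
Qed.

End SplitTotalQuotient.

(** * Quotients by sequences of a split extension *)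

Section SplitQuotient.
Variables (S R : comPzRingType).
Variables (i : {rmorphism S -> R}) (r : {additive R -> S}).
Hypothesis r_linear : forall b a, r (i b * a) = b * r a.
Hypothesis r1 : r 1 = 1.
Variable xs : seq S.
Let ys := map i xs.

Lemma seq_ideal_ext b : b \in seq_ideal xs -> i b \in seq_ideal ys.
Proof.
move=> /seq_idealP[c ->]; apply/seq_idealP; exists (i \o c).
rewrite size_map rmorph_sum; apply: eq_bigr => j _.
by rewrite rmorphM (nth_map 0).
Qed.

(** Together with [seq_ideal_ext], this says that the extension of an ideal of
    [S] to [R] meets [S] in the ideal itself. *)
Lemma seq_ideal_contract a : a \in seq_ideal ys -> r a \in seq_ideal xs.
Proof.
move=> /seq_idealP[c ->]; apply/seq_idealP; exists (r \o c).
rewrite size_map raddf_sum; apply: eq_bigr => j _.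
by rewrite (nth_map 0) //= mulrC r_linear mulrC.
Qed.

Definition quot_map (q : seq_quot xs) : seq_quot ys := seq_pi ys (i (repr q)).

Lemma quot_mapE b : quot_map (seq_pi xs b) = seq_pi ys (i b).
Proof.
by apply/seq_piP; rewrite -rmorphB; apply/seq_ideal_ext/seq_piP/seq_pi_repr.
Qed.

Definition quot_retract (q : seq_quot ys) : seq_quot xs :=
  seq_pi xs (r (repr q)).

Lemma quot_retractE a : quot_retract (seq_pi ys a) = seq_pi xs (r a).
Proof.
by apply/seq_piP; rewrite -raddfB; apply/seq_ideal_contract/seq_piP/seq_pi_repr.
Qed.

Fact quot_map_zmod : zmod_morphism quot_map.
Proof.
move=> p q; rewrite -[p]seq_pi_repr -[q]seq_pi_repr -raddfB.
by rewrite !quot_mapE -raddfB /= rmorphB.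
Qed.

Fact quot_map_monoid : monoid_morphism quot_map.
Proof.
split=> [|p q]; first by rewrite -(rmorph1 (seq_pi xs)) quot_mapE !rmorph1.
rewrite -[p]seq_pi_repr -[q]seq_pi_repr -rmorphM.
by rewrite !quot_mapE -rmorphM /= rmorphM.
Qed.

Fact quot_retract_zmod : zmod_morphism quot_retract.
Proof.
move=> p q; rewrite -[p]seq_pi_repr -[q]seq_pi_repr -raddfB.
by rewrite !quot_retractE -raddfB /= raddfB.
Qed.

HB.instance Definition _ := GRing.isZmodMorphism.Build (seq_quot xs)
  (seq_quot ys) quot_map quot_map_zmod.
HB.instance Definition _ := GRing.isMonoidMorphism.Build (seq_quot xs)
  (seq_quot ys) quot_map quot_map_monoid.
HB.instance Definition _ := GRing.isZmodMorphism.Build (seq_quot ys)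
  (seq_quot xs) quot_retract quot_retract_zmod.

Lemma quot_retract_linear p q :
  quot_retract (quot_map p * q) = p * quot_retract q.
Proof.
rewrite -[p]seq_pi_repr -[q]seq_pi_repr quot_mapE -rmorphM.
by rewrite !quot_retractE /= r_linear rmorphM.
Qed.

Lemma quot_retract1 : quot_retract 1 = 1.
Proof. by rewrite -(rmorph1 (seq_pi ys)) quot_retractE r1 rmorph1. Qed.

End SplitQuotient.

(** * Regular sequences *)

Section RegularSequences.
Variable A : comPzRingType.
Implicit Types (xs : seq A) (a y : A).

Lemma seq_pi_nzdP xs y : nonzerodivisor (seq_pi xs y) <->
  forall a, y * a \in seq_ideal xs -> a \in seq_ideal xs.
Proof.
have pi0 a : seq_pi xs a = 0 <-> a \in seq_ideal xs.
  rewrite -(raddf0 (seq_pi xs)).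
  by split=> [/seq_piP|h]; [|apply/seq_piP]; rewrite subr0.
split=> [yP a ya|yP q]; first by apply/pi0/yP; rewrite -rmorphM; apply/pi0.
by rewrite -[q]seq_pi_repr -rmorphM => /pi0/yP/pi0.
Qed.

Lemma seq_ideal_rcons xs y a :
  a \in seq_ideal (rcons xs y) <-> exists c, a - c * y \in seq_ideal xs.
Proof.
split=> [/seq_idealP[c ->]|[c /seq_idealP[d ad]]].
  exists (c (size xs)); apply/seq_idealP; exists c.
  rewrite size_rcons big_ord_recr /= nth_rcons ltnn eqxx addrK.
  by apply: eq_bigr => j _; rewrite nth_rcons ltn_ord.
apply/seq_idealP; exists (fun j => if j == size xs then c else d j).
rewrite size_rcons big_ord_recr /= eqxx nth_rcons ltnn eqxx.
rewrite -[LHS](subrK (c * y)) ad; congr (_ + _).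
by apply: eq_bigr => j _; rewrite nth_rcons ltn_ord ltn_eqF.
Qed.

Lemma seq_ideal_rconsW xs y a :
  a \in seq_ideal xs -> a \in seq_ideal (rcons xs y).
Proof. by move=> aI; apply/seq_ideal_rcons; exists 0; rewrite mul0r subr0. Qed.

(** The element [1] tests properness; the condition is only imposed on the
    longer sequence since ideals grow with the sequence. *)
Lemma regular_rcons xs y : regular_sequence (rcons xs y) <->
  [/\ regular_sequence xs, nonzerodivisor (seq_pi xs y)
    & 1 \notin seq_ideal (rcons xs y)].
Proof.
have nil_rcons : rcons xs y <> [::] by case: (xs).
split=> [[//|[[a aI] xsP]]|[xsR yP I1]].
  have I1 : 1 \notin seq_ideal (rcons xs y).
    by apply: contra aI => /seq_idealMl-/(_ a); rewrite mulr1.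
  split=> //; last first.
    have := xsP (size xs); rewrite size_rcons ltnSn => /(_ isT).
    by rewrite nth_rcons ltnn eqxx -cats1 take_size_cat.
  right; split=> [|j jxs].
    by exists 1; apply: contra I1 => /seq_ideal_rconsW.
  have := xsP j; rewrite size_rcons ltnS ltnW // => /(_ isT).
  by rewrite nth_rcons jxs -cats1 takel_cat // ltnW.
right; split=> [|j]; first by exists 1.
rewrite size_rcons ltnS leq_eqVlt => /predU1P[->|jxs].
  by rewrite nth_rcons ltnn eqxx -cats1 take_size_cat.
rewrite nth_rcons jxs -cats1 takel_cat; last exact: ltnW.
by case: xsR jxs => [->|[_ h] /h].
Qed.

End RegularSequences.

(** * Descent of subperfectness *)

Section SplitSubperfect.
Variables (S R : comPzRingType).
Variables (i : {rmorphism S -> R}) (r : {additive R -> S}).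
Hypothesis r_linear : forall b a, r (i b * a) = b * r a.
Hypothesis r1 : r 1 = 1.
Hypothesis norms : forall (xs : seq S) (s : R),
  nonzerodivisor (seq_pi (map i xs) s) ->
  exists t c, i t = s * c /\ nonzerodivisor (seq_pi (map i xs) (i t)).

Lemma quot_denominators xs (s : seq_quot (map i xs)) :
  s \in nzd (A:=seq_quot (map i xs)) ->
  exists t c, quot_map i t = s * c /\
    quot_map i t \in nzd (A:=seq_quot (map i xs)).
Proof.
rewrite -[s]seq_pi_repr => /asboolP/norms[t [c [tE tP]]].
exists (seq_pi xs t), (seq_pi (map i xs) c); rewrite quot_mapE -rmorphM -tE.
by split=> //; apply/asboolP.
Qed.

Hypothesis Rsub : regularly_subperfect R.

(** The regularity in [R] of the shorter sequence is what makes the quotient of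
    [R] subperfect, and this carries the next non-zero-divisor over. *)
Lemma regular_extend xs : regular_sequence xs -> regular_sequence (map i xs).
Proof.
elim/last_ind: xs => [|xs y IH]; first by left.
move=> /regular_rcons[/IH xsR yP I1]; rewrite map_rcons; apply/regular_rcons.
split=> //; last first.
  apply: contra I1; rewrite -map_rcons => /(seq_ideal_contract r_linear).
  by rewrite r1.
(* The retraction is defined on the quotient because it is linear, hence the
   extra premise. *)
have /(_ r_linear)/asboolP := nzd_extend (quot_retract_linear r_linear (xs:=xs))
  (quot_retract1 r_linear r1 xs) (@quot_denominators xs) (Rsub xsR)
  (introT (asboolP _) yP).
by rewrite /= quot_mapE.
Qed.

Lemma regularly_subperfect_descent : regularly_subperfect S.
Proof.
move=> xs /regular_extend xsR.
exact: (perfect_total_quot (quot_retract_linear r_linear (xs:=xs))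
  (quot_retract1 r_linear r1 xs) (@quot_denominators xs) (Rsub xsR)).
Qed.

(** If [y] extended the sequence in [R], then so would its multiple [i t], and
    [t] would extend it in [S]. *)
Lemma maximal_regular_extend xs :
  maximal_regular_sequence xs -> maximal_regular_sequence (map i xs).
Proof.
move=> [xsR xs_max]; split=> [|y]; first exact: regular_extend.
move=> /regular_rcons[_ /norms[t [c [tE /seq_pi_nzdP tP]]] I1].
apply: (xs_max t); apply/regular_rcons; split=> //.
  apply/seq_pi_nzdP => b tb; rewrite -[b](retractionK r_linear r1).
  by apply/seq_ideal_contract/tP => //; rewrite -rmorphM seq_ideal_ext.
apply: contra I1 => /seq_ideal_rcons[d dI]; apply/seq_ideal_rcons.
exists (i d * c); rewrite -mulrA (mulrC c) -tE -rmorphM -(rmorph1 i) -rmorphB.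
exact: seq_ideal_ext.
Qed.

End SplitSubperfect.

Theorem n_subperfect_descent (S R : comPzRingType) (i : {rmorphism S -> R})
    (r : {additive R -> S}) (n : nat) :
  (forall b a, r (i b * a) = b * r a) -> r 1 = 1 ->
  (forall (xs : seq S) (s : R), nonzerodivisor (seq_pi (map i xs) s) ->
    exists t c, i t = s * c /\ nonzerodivisor (seq_pi (map i xs) (i t))) ->
  n_subperfect R n -> n_subperfect S n.
Proof.
move=> r_linear r1 norms [Rsub Rn].
split=> [|xs xs_max]; first exact: regularly_subperfect_descent Rsub.
by rewrite -(Rn (map i xs)) ?size_map //; exact: maximal_regular_extend xs_max.
Qed.

(** * Norms and averages over a finite group *)

Section Invariants.
Variables (G : finGroupType) (R : comPzRingType) (to : ring_action G R).

Definition aut (g : G) (s : R) : R := to s g.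

HB.instance Definition _ (g : G) :=
  GRing.isZmodMorphism.Build R R (aut g) (ring_act_zmod to g).
HB.instance Definition _ (g : G) :=
  GRing.isMonoidMorphism.Build R R (aut g) (ring_act_monoid to g).

Lemma aut_comp g h s : aut h (aut g s) = aut (g * h)%g s.
Proof.
rewrite /aut; case: to => -[f [f_inj fM]] aut_zmod aut_monoid /=.
by rewrite fM ?inE.
Qed.

Lemma aut1 s : aut 1%g s = s.
Proof.
have aut_inj g : injective (aut g).
  rewrite /aut; case: to => -[f [f_inj fM]] aut_zmod aut_monoid.
  exact: f_inj.
by apply: (aut_inj 1%g); rewrite aut_comp mulg1.
Qed.

Lemma aut_val g (b : invariants to) : aut g (val b) = val b.
Proof. exact: (invariantP to _ (valP b)). Qed.

Definition norm (s : R) : R := \prod_(g : G) aut g s.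

Fact norm_invariant s : norm s \in Defs.invariant to.
Proof.
apply/invariantP => h; rewrite -/(aut h _) rmorph_prod /=.
rewrite [RHS](reindex_inj (mulIg h)) /=.
by apply: eq_bigr => g _; rewrite aut_comp.
Qed.

Lemma aut_seq_ideal g (xs : seq (invariants to)) a :
  a \in seq_ideal (map val xs) -> aut g a \in seq_ideal (map val xs).
Proof.
move=> /seq_idealP[c ->]; apply/seq_idealP; exists (aut g \o c).
rewrite rmorph_sum; apply: eq_bigr => -[j /= jxs] _; rewrite rmorphM /=.
by rewrite (nth_map 0) ?aut_val // -(size_map val).
Qed.

(** The ideal is stable under the group, so each conjugate of [s] is again a
    non-zero-divisor modulo it. *)
Lemma norm_nzd (xs : seq (invariants to)) s :
  nonzerodivisor (seq_pi (map val xs) s) ->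
  nonzerodivisor (seq_pi (map val xs) (norm s)).
Proof.
move=> /seq_pi_nzdP sP; apply/seq_pi_nzdP; rewrite /norm.
elim/big_ind: _ => [a|p q pP qP a|g _ a]; first by rewrite mul1r.
  by rewrite -mulrA => /pP/qP.
move=> /(aut_seq_ideal g^-1); rewrite rmorphM /= aut_comp mulgV aut1.
move=> /sP/(aut_seq_ideal g).
by rewrite aut_comp mulVg aut1.
Qed.

Lemma norm_dvd s : exists c, norm s = s * c.
Proof. by rewrite /norm (bigD1 1%g) //= aut1; eexists. Qed.

Section Reynolds.
Variable u : R.
Hypothesis uG : u * #|G|%:R = 1.

(** Inverses are unique and [#|G|%:R] is fixed. *)
Lemma aut_inv_card g : aut g u = u.
Proof.
have gG : aut g u * #|G|%:R = 1.
  by rewrite -(rmorph_nat (aut g)) -rmorphM uG rmorph1.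
by rewrite -[LHS]mulr1 -uG mulrCA gG mulr1.
Qed.

Definition average (a : R) : R := u * \sum_(g : G) aut g a.

Fact average_invariant a : average a \in Defs.invariant to.
Proof.
apply/invariantP => h; rewrite -/(aut h _) rmorphM rmorph_sum /= aut_inv_card.
congr (_ * _); rewrite [RHS](reindex_inj (mulIg h)) /=.
by apply: eq_bigr => g _; rewrite aut_comp.
Qed.

Definition reynolds (a : R) : invariants to := Invariants (average_invariant a).

Fact reynolds_zmod : zmod_morphism reynolds.
Proof.
move=> a b; apply: val_inj; rewrite raddfB /= /average -mulrBr -sumrB.
by congr (_ * _); apply: eq_bigr => g _; rewrite rmorphB.
Qed.

HB.instance Definition _ :=
  GRing.isZmodMorphism.Build R (invariants to) reynolds reynolds_zmod.

Lemma reynolds_linear (b : invariants to) a :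
  reynolds (val b * a) = b * reynolds a.
Proof.
apply: val_inj; rewrite rmorphM /= /average mulrCA; congr (_ * _).
by rewrite mulr_sumr; apply: eq_bigr => g _; rewrite rmorphM /= aut_val.
Qed.

Lemma reynolds1 : reynolds 1 = 1.
Proof.
apply: val_inj; rewrite rmorph1 /= /average -[RHS]uG; congr (_ * _).
rewrite -sum1_card natr_sum; apply: eq_bigr => g _; exact: rmorph1.
Qed.

End Reynolds.
End Invariants.

Theorem corollary5p2 (n : nat) (R : comPzRingType) (G : finGroupType)
    (to : ring_action G R) :
  n_subperfect R n ->
  (exists u : R, u * #|G|%:R = 1) ->
  n_subperfect (invariants to) n.
Proof.
move=> Rn [u uG].
apply: (n_subperfect_descent (i := val) (r := reynolds to uG)) Rn.
- exact: reynolds_linear.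
- exact: reynolds1.
- move=> xs s sP; have [c sc] := norm_dvd to s.
  by exists (Invariants (norm_invariant to s)), c; split=> //; exact: norm_nzd.
Qed.
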